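(* Let $K$ be an infinite field of characteristic different from $2$ and $3$, and let $A$ be a unital associative $K$-algebra generated (as a unital algebra) by three elements. Then for all integers $m,n\ge 2$, $$T^{(m)}(A)\cdot T^{(n)}(A)\subseteq T^{(m+n-1)}(A).$$
   Context: Commutators: $[a_1,a_2]=a_1a_2-a_2a_1$ and inductively $[a_1,\dots,a_n]=[[a_1,\dots,a_{n-1}],a_n]$. For an associative algebra $A$ and $n\ge 2$, $T^{(n)}(A)$ denotes the two-sided ideal of $A$ generated by all commutators $[a_1,\dots,a_n]$ with $a_1,\dots,a_n\in A$. The product $I\cdot J$ of two ideals is the linear span of all products $ij$ with $i\in I$, $j\in J$. *)

(* Defs.v *)
From mathcomp Require Import all_boot all_algebra.
From mathcomp Require Import classical_sets cardinality.

Set Implicit Arguments.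
Unset Strict Implicit.
Unset Printing Implicit Defensive.

Import GRing.Theory.
Local Open Scope ring_scope.
Local Open Scope classical_set_scope.

Section Algebra.
Variables (K : fieldType) (A : algType K).
Implicit Types (a b c : A) (S I J : set A).

Definition linear_span S : set A :=
  smallest (fun M : set A => GRing.submod_closed (mem M)) S.

Definition subalgebra_gen S : set A :=
  smallest (fun M : set A => GRing.subalg_closed (mem M)) S.

Definition two_sided_ideal I : Prop :=
  [/\ GRing.submod_closed (mem I),
      forall a c, I c -> I (a * c)
    & forall a c, I c -> I (c * a)].

Definition ideal_gen S : set A := smallest two_sided_ideal S.

Definition ideal_prod I J : set A :=
  linear_span [set i * j | i in I & j in J].

Definition commutator a b : A := a * b - b * a.

(* [:: a1; ...; an] is sent to [[...[[a1, a2], a3], ...], an]; the value 0 on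
   the empty sequence is a dummy. *)
Definition long_commutator (s : seq A) : A :=
  if s is a :: s' then foldl commutator a s' else 0.

Definition T_ideal (n : nat) : set A :=
  ideal_gen [set long_commutator t | t in [set: n.-tuple A]].

End Algebra.

Arguments T_ideal {K} A n.

(* Main.v *)
Require Import Defs.
From mathcomp Require Import all_boot all_algebra zify.
From mathcomp Require Import classical_sets cardinality.
From Stdlib Require Ncring Ncring_tac.

(** Write [L_k] for the span of the left-normed commutators of length [k] and
    [x o u = x u + u x].  If [[x o u, v]] lies in [L_(j+1)] for all letters
    [x, v] and all words [u] of length [j] over a set [S] of letters, then so
    does [[x o u, l]] in [L_(j+k)] for words [l] of length [k] (Jacobi), and
    expanding [[u a, l]] puts the product of two words of lengths [j] and [n]
    into [T^(j+n-1)].  This property passes from [j] to [j + 2] (by way of the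
    case [j = 3], treated directly).  It holds for [j = 1] and any [S], which
    settles odd [j]; for [j = 2] it holds when [S] has three elements, because
    [[x o [w, y], v]] is alternating in four letters modulo [L_3].  For [m], [n] both even the words in the three generators are
    thus under control, and arbitrary words reduce to them since, by induction
    on [m + n] and the odd case, every entry acts as a derivation modulo
    [T^(m+n-1)]. *)

Set Implicit Arguments.
Unset Strict Implicit.
Unset Printing Implicit Defensive.

Import GRing.Theory.
Local Open Scope ring_scope.
Local Open Scope classical_set_scope.

(** * Noncommutative ring identities by reflection *)

#[local] Instance nzRing_ops (A : nzRingType) :
  @Ncring.Ring_ops A 0 1 +%R *%R (fun x y => x - y) -%R eq := {}.

#[local] Instance nzRing_Ring (A : nzRingType) :
  Ncring.Ring (Ro := nzRing_ops A).
Proof.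
constructor; try exact _.
- exact: add0r.
- exact: addrC.
- exact: addrA.
- exact: mul1r.
- exact: mulr1.
- exact: mulrA.
- exact: mulrDl.
- by move=> x y z; exact: mulrDr.
- by [].
- exact: subrr.
Qed.

Arguments commutator {K A} a b.

Definition jordan {K : fieldType} {A : algType K} (a b : A) : A :=
  a * b + b * a.

Ltac ncring := rewrite /jordan /commutator; Ncring_tac.non_commutative_ring.

(** * Linear subspaces and spans *)

Section Submodules.
Context {K : fieldType} {A : algType K}.
Implicit Types (M S P : set A) (a b u v : A).

Lemma submod_closedP M : GRing.submod_closed (mem M) <->
  M 0 /\ forall k u v, M u -> M v -> M (k *: u + v).
Proof.
split=> [[M0 ML]|[M0 ML]]; split; rewrite ?in_setE //.
- by move: M0; rewrite in_setE.
- by move=> k u v Mu Mv; move: (ML k u v); rewrite !in_setE; apply.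
- by move=> k u v; rewrite !in_setE; exact: ML.
Qed.

Section Closure.
Variable M : set A.
Hypothesis subM : GRing.submod_closed (mem M).

Lemma sub0 : M 0. Proof. by case/submod_closedP: subM. Qed.

Lemma subD u v : M u -> M v -> M (u + v).
Proof.
by case/submod_closedP: subM => _ ML Mu Mv; rewrite -(scale1r u); exact: ML.
Qed.

Lemma subZ k u : M u -> M (k *: u).
Proof.
case/submod_closedP: subM => M0 ML Mu.
by rewrite -(addr0 (k *: u)); exact: ML.
Qed.

Lemma subN u : M u -> M (- u).
Proof. by rewrite -scaleN1r; exact: subZ. Qed.

Lemma subB u v : M u -> M v -> M (u - v).
Proof. by move=> Mu Mv; apply: subD => //; exact: subN. Qed.

(** The characteristic hypotheses enter the argument through this division by an integer invertible
    in [K]. *)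
Lemma sub_mulrn p u : prime p -> p \notin [pchar K] -> M (u *+ p) -> M u.
Proof.
move=> p_pr pK Mu.
have pN0 : p%:R != 0 :> K by apply: contra pK => p0; rewrite inE /= p_pr.
by rewrite -(scalerK pN0 u) scaler_nat; exact: subZ.
Qed.

Lemma sub_double u : 2%N \notin [pchar K] -> M (u + u) -> M u.
Proof. by move=> K2 Mu; apply: (@sub_mulrn 2) => //; rewrite mulr2n. Qed.

Lemma sub_triple u : 3%N \notin [pchar K] -> M (u + u + u) -> M u.
Proof.
by move=> K3 Mu; apply: (@sub_mulrn 3) => //; rewrite mulrSr mulr2n.
Qed.

End Closure.

Lemma linear_span_submod S : GRing.submod_closed (mem (linear_span S)).
Proof.
apply/submod_closedP; split=> [M [subM _]|k u v Su Sv M [subM SM]].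
  exact: sub0.
by apply: subD => //; [apply: subZ => //; apply: Su|apply: Sv].
Qed.

Lemma linear_span_gen S u : S u -> linear_span S u.
Proof. exact: sub_gen_smallest. Qed.

Lemma linear_span_ind S P : GRing.submod_closed (mem P) -> S `<=` P ->
  linear_span S `<=` P.
Proof. exact: smallest_sub. Qed.

Lemma preimage_submod M (f : A -> A) : GRing.submod_closed (mem M) ->
  linear f -> GRing.submod_closed (mem (f @^-1` M)).
Proof.
move=> subM fL; pose F := GRing.isLinear.Build _ _ _ _ f fL.
apply/submod_closedP; split=> [|k u v /= Mu Mv].
  (* Writing 0 as [-1 *: 0 + 0] makes the combined form of linearity yield [f 0 = 0]. *)
  rewrite /preimage /= -(addNr 0) -[X in X + _]scaleN1r fL scaleN1r addNr.
  exact: sub0.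
by rewrite fL; apply: subD => //; exact: subZ.
Qed.

End Submodules.

(** * Left-normed commutators, the lower central series and the ideals [T_ideal] *)

Section Lie_words.
Context {K : fieldType} {A : algType K}.
Implicit Types (S : set A) (a b u v w x y z : A) (s : seq A).

Lemma commutatorNl u a : commutator (- u) a = - commutator u a.
Proof. by ncring. Qed.

Lemma commutator_linearl a : linear (fun u : A => commutator u a).
Proof.
move=> k u v.
by rewrite /commutator mulrDl mulrDr -scalerAl -scalerAr opprD addrACA scalerBr.
Qed.

Lemma commutator_linearr a : linear (fun u : A => commutator a u).
Proof.
move=> k u v.
by rewrite /commutator mulrDl mulrDr -scalerAl -scalerAr opprD addrACA scalerBr.
Qed.

(** The alphabet is a parameter, so that words in the generators and words in arbitrary elements
    ([setT]) are treated alike. *)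
Inductive lie_word S : nat -> A -> Prop :=
| lie_letter a : S a -> lie_word S 1 a
| lie_bracket n u a : lie_word S n u -> S a -> lie_word S n.+1 (commutator u a).

Lemma lie_word_gt0 S n u : lie_word S n u -> (0 < n)%N.
Proof. by case. Qed.

Lemma lie_word_inv S n w : lie_word S n.+2 w ->
  exists u a, [/\ lie_word S n.+1 u, S a & w = commutator u a].
Proof.
by move=> W; inversion W as [|k u a Wu Sa]; subst; exists u, a.
Qed.

Lemma lie_wordT S n u : lie_word S n u -> lie_word setT n u.
Proof. by elim=> *; constructor. Qed.

Lemma foldl_lie_word S n u s : lie_word S n u -> {in s, forall a, S a} ->
  lie_word S (n + size s) (foldl commutator u s).
Proof.
elim: s n u => [|a s IHs] n u Wu Ss /=; first by rewrite addn0.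
rewrite addnS -addSn; apply: IHs => [|b bs].
  by apply: lie_bracket => //; apply: Ss; rewrite mem_head.
by apply: Ss; rewrite inE bs orbT.
Qed.

(** The lower central series of [A] as a Lie algebra, numbered so that term 1 is all of [A]. No word
    has length 0, so term 0 is zero; hence the positivity hypotheses below. *)
Definition lower_central n : set A := linear_span (lie_word setT n).
Local Notation L := lower_central.

Lemma L_submod n : GRing.submod_closed (mem (L n)).
Proof. exact: linear_span_submod. Qed.
Hint Resolve L_submod : core.

Lemma L_word S n u : lie_word S n u -> L n u.
Proof. by move=> /lie_wordT; exact: linear_span_gen. Qed.

Lemma L_one a : L 1 a.
Proof. by apply: (@L_word setT); constructor. Qed.

Lemma L_bracket n u a : L n u -> L n.+1 (commutator u a).
Proof.
suff: L n `<=` (fun v => commutator v a) @^-1` L n.+1 by exact.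
apply: linear_span_ind.
  by apply: preimage_submod => //; exact: commutator_linearl.
by move=> v Wv; apply: (@L_word setT); constructor.
Qed.

(** The innermost bracket of a word over [setT] counts as a single letter. *)
Lemma L_subS n : (0 < n)%N -> L n.+1 `<=` L n.
Proof.
move=> n0; apply: linear_span_ind => // w Ww.
elim: n n0 w Ww => [//|[|n] IHn] _ w Ww; first exact: L_one.
have [u [a [Wu _ ->]]] := lie_word_inv Ww.
by apply: L_bracket; exact: IHn.
Qed.

Lemma L_sub m n : (0 < n <= m)%N -> L m `<=` L n.
Proof.
case/andP=> n0 nm; rewrite -(subnKC nm).
elim: (m - n)%N => [|k IHk] u; first by rewrite addn0.
by rewrite addnS => /L_subS Lu; apply: IHk; apply: Lu; lia.
Qed.

Lemma L_commutator p q u v : L p u -> L q v -> L (p + q) (commutator u v).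
Proof.
move=> Lu; suff: L q `<=` commutator u @^-1` L (p + q) by exact.
apply: linear_span_ind.
  by apply: preimage_submod => //; exact: commutator_linearr.
move=> w Ww; rewrite /preimage /=.
elim: Ww p u Lu => {w q} [a _|k l a _ IH _] p u Lu.
  by rewrite addn1; exact: L_bracket.
have -> : commutator u (commutator l a) =
    commutator (commutator u l) a - commutator (commutator u a) l by ncring.
apply: (subB (L_submod _)); first by rewrite addnS; apply: L_bracket; exact: IH.
by rewrite addnS -addSn; apply: IH; exact: L_bracket.
Qed.

(** Positivity excludes the dummy value of [long_commutator] on the empty tuple. *)
Lemma long_commutator_lie_word n : (0 < n)%N ->
  [set long_commutator t | t in [set: n.-tuple A]] = lie_word setT n.
Proof.
case: n => // n _; apply/seteqP; split=> [_ [t _ <-]|w].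
  case/tupleP: t => a t; rewrite /long_commutator /=.
  have := @foldl_lie_word setT 1 a t; rewrite size_tuple add1n; apply=> //.
  by constructor.
elim: n w => [|n IHn] w Ww.
  by inversion Ww as [a|k u a Wu]; [exists [tuple w]|inversion Wu].
have [u [a [/IHn[t _ <-] _ ->]]] := lie_word_inv Ww.
exists [tuple of rcons t a] => //; rewrite /long_commutator /=.
by case/tupleP: t => b t /=; rewrite foldl_rcons.
Qed.

Section Ideals.
Variable I : set A.
Hypothesis idealI : two_sided_ideal I.

Lemma ideal_submod : GRing.submod_closed (mem I). Proof. by case: idealI. Qed.

Lemma ideal_mull a c : I c -> I (a * c).
Proof. by case: idealI => _ + _; apply. Qed.

Lemma ideal_mulr a c : I c -> I (c * a).
Proof. by case: idealI => _ _; apply. Qed.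

End Ideals.

Lemma mull_linear a : linear (fun u : A => a * u).
Proof. by move=> k u v; rewrite mulrDr scalerAr. Qed.

Lemma mulr_linear a : linear (fun u : A => u * a).
Proof. by move=> k u v; rewrite mulrDl scalerAl. Qed.

Lemma ideal_gen_ideal S : two_sided_ideal (ideal_gen S).
Proof.
split=> [|a c Sc I [idI SI]|a c Sc I [idI SI]].
- apply/submod_closedP.
  split=> [I [/ideal_submod idI _]|k u v Su Sv I [idI SI]].
    exact: sub0.
  have subI := ideal_submod idI.
  by apply: subD => //; [apply: subZ => //; apply: Su|apply: Sv].
- by apply: ideal_mull => //; exact: Sc.
- by apply: ideal_mulr => //; exact: Sc.
Qed.

(** The free middle factor [b] absorbs a multiplier to the right of [u] or to the left of [v], so
    the conditions on [u], then on [v], cut out ideals. *)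
Lemma ideal_prod_gen_sub S S' I : two_sided_ideal I ->
    (forall u v b, S u -> S' v -> I (u * b * v)) ->
  ideal_prod (ideal_gen S) (ideal_gen S') `<=` I.
Proof.
move=> idI H; have subI := ideal_submod idI.
have step1 : ideal_gen S `<=` [set u | forall b v, S' v -> I (u * b * v)].
  apply: smallest_sub => [|u Su b v S'v]; last exact: H.
  split=> [|a c Ic b v S'v|a c Ic b v S'v].
  - apply/submod_closedP; split=> [b v _|k u u' Iu Iu' b v S'v].
      by rewrite !mul0r; exact: sub0.
    rewrite !mulrDl -!scalerAl; apply: subD => //; last exact: Iu'.
    by apply: subZ => //; exact: Iu.
  - by rewrite -!mulrA; apply: (ideal_mull idI); rewrite mulrA; exact: Ic.
  - by rewrite -(mulrA c); exact: Ic.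
have step2 : ideal_gen S' `<=`
    [set v | forall u b, ideal_gen S u -> I (u * b * v)].
  apply: smallest_sub => [|v S'v u b Su]; last exact: step1.
  split=> [|a c Ic u b Su|a c Ic u b Su].
  - apply/submod_closedP; split=> [u b _|k v v' Iv Iv' u b Su].
      by rewrite mulr0; exact: sub0.
    rewrite mulrDr -scalerAr; apply: subD => //; last exact: Iv'.
    by apply: subZ => //; exact: Iv.
  - by rewrite mulrA -(mulrA u); exact: Ic.
  - by rewrite mulrA; apply: (ideal_mulr idI); exact: Ic.
apply: linear_span_ind => // _ [u Su [v S'v <-]].
by rewrite -(mulr1 u); exact: step2.
Qed.

Local Notation T := (T_ideal A).

Lemma T_is_ideal n : two_sided_ideal (T n).
Proof. exact: ideal_gen_ideal. Qed.
Hint Resolve T_is_ideal : core.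

Lemma T_submod n : GRing.submod_closed (mem (T n)).
Proof. exact: ideal_submod. Qed.
Hint Resolve T_submod : core.

Lemma L_sub_T n : (0 < n)%N -> L n `<=` T n.
Proof.
move=> n0; apply: linear_span_ind => // w.
by rewrite -long_commutator_lie_word //; exact: sub_gen_smallest.
Qed.

Lemma T_subS n : (0 < n)%N -> T n.+1 `<=` T n.
Proof.
move=> n0; apply: smallest_sub => // w; rewrite long_commutator_lie_word //.
by move=> /L_word Lw; apply: L_sub_T => //; exact: L_subS.
Qed.

Definition L_mul_sub_T m n :=
  forall w c, L m w -> L n c -> T (m + n - 1) (w * c).

Lemma L_mul_sub_T_words m n :
    (forall w c, lie_word setT m w -> lie_word setT n c ->
      T (m + n - 1) (w * c)) ->
  L_mul_sub_T m n.
Proof.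
move=> H w c Lw Lc.
suff: L m `<=` (fun u => u * c) @^-1` T (m + n - 1) by exact.
apply: linear_span_ind => [|{Lw}w Ww].
  exact: (preimage_submod (T_submod _) (mulr_linear _)).
suff: L n `<=` (fun u => w * u) @^-1` T (m + n - 1) by exact.
apply: linear_span_ind => [|{Lc}c Wc].
  exact: (preimage_submod (T_submod _) (mull_linear _)).
exact: H.
Qed.

(** Since u b v = b (u v) + [u, b] v with [u, b] in [L m], the middle factor can be removed. *)
Lemma T_mul_sub_T m n : (0 < m)%N -> (0 < n)%N -> L_mul_sub_T m n ->
  ideal_prod (T m) (T n) `<=` T (m + n - 1).
Proof.
move=> m0 n0 H; apply: ideal_prod_gen_sub => // u v b.
rewrite !long_commutator_lie_word // => /L_word Lu /L_word Lv.
have -> : u * b * v = b * (u * v) + commutator u b * v by ncring.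
apply: (subD (T_submod _)).
  by apply: (ideal_mull (T_is_ideal _)); exact: H.
by apply: H => //; apply: L_subS => //; exact: L_bracket.
Qed.

(** Swapping the factors costs [w, c], which lies in [L (m + n)]. *)
Lemma L_mul_sub_TC m n w c : (0 < m)%N -> (0 < n)%N -> L m w -> L n c ->
  T (m + n - 1) (w * c) -> T (m + n - 1) (c * w).
Proof.
move=> m0 n0 Lw Lc Twc; have -> : c * w = w * c - commutator w c by ncring.
apply: (subB (T_submod _)) => //; apply: L_sub_T; first by lia.
by apply: (@L_sub (m + n)); [lia|exact: L_commutator].
Qed.

Lemma L_mul_sub_T_sym m n : (0 < m)%N -> (0 < n)%N ->
  L_mul_sub_T m n -> L_mul_sub_T n m.
Proof.
move=> m0 n0 H w c Lw Lc; rewrite addnC.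
by apply: L_mul_sub_TC => //; exact: H.
Qed.

End Lie_words.

(** * Brackets of Jordan products, and the case of an odd index *)

Section Jordan_products.
Context {K : fieldType} {A : algType K}.
Hypothesis K2 : 2%N \notin [pchar K].
Implicit Types (S M : set A) (a b u v w x y z t l q : A).
Local Notation L := (lower_central (A := A)).
Local Notation T := (T_ideal A).
Local Notation LS n := (L_submod (A := A) n).
Local Notation TS n := (T_submod (A := A) n).

Definition jordan_bracket_depth S j :=
  forall x u v, S x -> lie_word S j u -> S v ->
  L j.+1 (commutator (jordan x u) v).

Lemma jordan_bracket_word S j k x u l : jordan_bracket_depth S j ->
    S x -> lie_word S j u -> lie_word S k l ->
  L (j + k) (commutator (jordan x u) l).
Proof.
move=> Cj Sx Wu; elim=> {l k} [a Sa|k l a Wl IH Sa].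
  by rewrite addn1; exact: Cj.
have -> : commutator (jordan x u) (commutator l a) =
    commutator (commutator (jordan x u) l) a
    - commutator (commutator (jordan x u) a) l by ncring.
apply: (subB (LS _)); first by rewrite addnS; exact: L_bracket.
rewrite addnS -addSn; apply: L_commutator; first exact: Cj.
exact: L_word Wl.
Qed.

(** For c = [l, a] one has w [l, a] = [w, l] a - [w a, l], and 2 w a = a o w + [w, a]. The depth
    hypothesis handles [a o w, l]; the other terms are long enough. *)
Lemma mul_lie_word S m n w c : jordan_bracket_depth S m -> (1 < n)%N ->
  lie_word S m w -> lie_word S n c -> T (m + n - 1) (w * c).
Proof.
case: n => [|[|n]] // Cm _ Ww Wc.
have [l [a [Wl Sa ->]]] := lie_word_inv Wc.
have Lm := L_word Ww; have Ll := L_word Wl; have m0 := lie_word_gt0 Ww.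
have -> : (m + n.+2 - 1 = m + n.+1)%N by lia.
have sT : L (m + n.+1) `<=` T (m + n.+1) by apply: L_sub_T; lia.
apply: (sub_double (TS _)) => //.
have -> : w * commutator l a + w * commutator l a =
    commutator w l * a + commutator w l * a
    - (commutator (jordan a w) l + commutator (commutator w a) l) by ncring.
have Twl : T (m + n.+1) (commutator w l * a).
  by apply: (ideal_mulr (T_is_ideal _)); apply: sT; exact: L_commutator.
apply: (subB (TS _)); first exact: (subD (TS _)).
apply: sT; apply: (subD (LS _)); first exact: (jordan_bracket_word Cm).
apply: (@L_sub _ _ (m.+1 + n.+1)); first by lia.
by apply: L_commutator => //; exact: L_bracket.
Qed.

Lemma jordan_bracket_depth1 S : jordan_bracket_depth S 1.
Proof. by move=> x u v _ _ _; apply: L_bracket; exact: L_one. Qed.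

(* Modulo L_4, [x o [z, t, y], v] has the symmetries of a curvature tensor in
   (x, y | z, t) and is alternating in x, y, v.  The pair symmetry makes it
   invariant under cyclic shifts of (v, z, t), so that the Bianchi identity says
   that its triple vanishes. *)
Lemma jordan_bracket_depth3 : 3%N \notin [pchar K] ->
  jordan_bracket_depth (setT : set A) 3.
Proof.
move=> K3.
pose f x y v z t :=
  commutator (jordan x (commutator (commutator z t) y)) v.
have L3 z t y : L 3 (commutator (commutator z t) y).
  by do 2!apply: L_bracket; exact: L_one.
have alt_xy x y v z t : L 4 (f x y v z t + f y x v z t).
  have -> : f x y v z t + f y x v z t =
      commutator (commutator (commutator z t) (jordan x y)) v.
    by rewrite /f; ncring.
  exact: L_bracket.
have alt_xv x y v z t : L 4 (f x y v z t + f v y x z t).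
  have -> : f x y v z t + f v y x z t =
      commutator (commutator (commutator z t) y) (jordan x v).
    by rewrite /f; ncring.
  exact: L_bracket.
(* As for curvature tensors: antisymmetry in (z, t) and the cyclic identity in (z, t, y) hold
   exactly, so only swaps of the first two arguments remain. *)
have pair_sym x y v z t : L 4 (f x y v z t - f z t v x y).
  apply: (sub_double (LS _)) => //.
  have -> : f x y v z t - f z t v x y + (f x y v z t - f z t v x y) =
      (f x y v z t + f y x v z t) - (f z t v x y + f t z v x y)
      - (f x z v t y + f z x v t y) - (f x t v y z + f t x v y z)
      + (f y z v t x + f z y v t x) + (f y t v x z + f t y v x z).
    by rewrite /f; ncring.
  by do 2!apply: (subD (LS _)) => //; do 3!apply: (subB (LS _)) => //.
have cyc x y v z t : L 4 (f x y v z t - f x y z t v).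
  have -> : f x y v z t - f x y z t v =
      (f x y v z t - f z t v x y) + (f z t v x y + f v t z x y)
      - (f v t z x y + f t v z x y) + (f t v z x y - f x y z t v).
    by rewrite /f; ncring.
  apply: (subD (LS _)) => //; apply: (subB (LS _)) => //.
  exact: (subD (LS _)).
have alt_yv x y v z t : L 4 (f x y v z t + f x v y z t).
  have -> : f x y v z t + f x v y z t =
      (f x y v z t + f y x v z t) - (f y x v z t + f v x y z t)
      + (f v x y z t + f x v y z t).
    by rewrite /f; ncring.
  by apply: (subD (LS _)) => //; apply: (subB (LS _)).
move=> x w v _ W3 _.
have [u [y [W2 _ ->]]] := lie_word_inv W3.
have [z [t [_ _ ->]]] := lie_word_inv W2.
apply: (sub_triple (LS _)) => //; rewrite -/(f x y v z t).
have -> : f x y v z t + f x y v z t + f x y v z t =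
    (f x y v z t - f x y z t v) - (f x y t v z - f x y v z t)
    + ((f x y v z t + f x v y z t) + (f x y z t v + f x z y t v)
       + (f x y t v z + f x t y v z)).
  by rewrite /f; ncring.
apply: (subD (LS _)); first exact: (subB (LS _)).
by do 2!apply: (subD (LS _)) => //.
Qed.

(* With [q = [[z, y], x]], the Jacobi identity reduces the symmetry in (z, y) of
   [x o [u, z, y], v] to [u o q, v], which the derivation property splits into
   brackets of [v o q] and [v o u] covered by the depths 3 and i. *)
Lemma jordan_bracket_depthSS S i : (0 < i)%N ->
    jordan_bracket_depth (setT : set A) 3 ->
    jordan_bracket_depth S i ->
  jordan_bracket_depth S i.+2.
Proof.
case: i => // i _ C3 Ci x w v Sx Ww Sv.
have [w1 [y [Ww1 Sy ->]]] := lie_word_inv Ww.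
have [u [z [Wu Sz ->]]] := lie_word_inv Ww1.
pose phi z y x := commutator (jordan x (commutator (commutator u z) y)) v.
have anti a b c : S a -> L i.+4 (phi a b c + phi a c b).
  move=> Sa; have -> : phi a b c + phi a c b =
      commutator (commutator (commutator u a) (jordan b c)) v.
    by rewrite /phi; ncring.
  by do 3!apply: L_bracket; exact: L_word Wu.
have symm a b c : S a -> S b -> S c -> L i.+4 (phi a b c - phi b a c).
  move=> Sa Sb Sc; pose q := commutator (commutator a b) c.
  have Wq : lie_word S 3 q by do 3?constructor.
  have -> : phi a b c - phi b a c =
      commutator (commutator (jordan c u) (commutator a b)) v
      - commutator (jordan v q) u - commutator (jordan v u) q.
    by rewrite /phi /q; ncring.
  have -> : i.+4 = (i.+1 + 2).+1 by lia.
  apply: (subB (LS _)); first apply: (subB (LS _)).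
  - apply: L_bracket; apply: (@jordan_bracket_word S) => //.
    by do 2?constructor.
  - have -> : ((i.+1 + 2).+1 = 3 + i.+1)%N by lia.
    by apply: (jordan_bracket_word C3) => //; apply: lie_wordT; eassumption.
  - have -> : ((i.+1 + 2).+1 = i.+1 + 3)%N by lia.
    exact: (jordan_bracket_word Ci).
(* Alternating three swaps of the last two arguments (sign -1) with three of the first two (sign +1)
   leads from [phi z y x] to its negative. *)
apply: (sub_double (LS _)) => //; rewrite -/(phi z y x).
have -> : phi z y x + phi z y x =
    (phi z y x + phi z x y) - (phi z x y - phi x z y)
    - (phi x z y + phi x y z) + (phi x y z - phi y x z)
    + (phi y x z + phi y z x) + (phi z y x - phi y z x).
  by rewrite /phi; ncring.
apply: (subD (LS _)); last exact: symm.
apply: (subD (LS _)); last exact: anti.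
apply: (subD (LS _)); last exact: symm.
apply: (subB (LS _)); last exact: anti.
by apply: (subB (LS _)); [exact: anti|exact: symm].
Qed.

Lemma jordan_bracket_depth_parity S i k : (0 < i)%N ->
    jordan_bracket_depth (setT : set A) 3 -> jordan_bracket_depth S i ->
  jordan_bracket_depth S (i + k.*2).
Proof.
move=> i0 C3 Ci; elim: k => [|k IHk]; first by rewrite addn0.
by rewrite doubleS !addnS; apply: jordan_bracket_depthSS => //; lia.
Qed.

(** Four arguments drawn from three letters contain a repetition, and [f], alternating modulo [L 3],
    then falls into [L 3]. *)
Lemma jordan_bracket_depth2_three x y z :
  jordan_bracket_depth [set x; y; z] 2.
Proof.
pose f a b c d := commutator (jordan a (commutator b c)) d.
have alt12 a b c d : L 3 (f a b c d + f b a c d).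
  have -> : f a b c d + f b a c d =
      commutator (commutator (jordan a b) c) d by rewrite /f; ncring.
  by do 2!apply: L_bracket; exact: L_one.
have alt14 a b c d : L 3 (f a b c d + f d b c a).
  have -> : f a b c d + f d b c a =
      commutator (commutator b c) (jordan a d) by rewrite /f; ncring.
  by do 2!apply: L_bracket; exact: L_one.
have eq23 a b d : f a b b d = 0 by rewrite /f; ncring.
have eq12 a c d : L 3 (f a a c d) by apply: (sub_double (LS _)).
have eq14 a b c : L 3 (f a b c a) by apply: (sub_double (LS _)).
have eq13 a b d : L 3 (f a b a d).
  have -> : f a b a d = - f a a b d by rewrite /f; ncring.
  exact: (subN (LS _)).
have eq24 a b c : L 3 (f a b c b).
  have -> : f a b c b = (f a b c b + f b a c b) - f b a c b.
    by rewrite /f; ncring.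
  exact: (subB (LS _)).
have eq34 a b c : L 3 (f a b c c).
  have -> : f a b c c = - f a c b c by rewrite /f; ncring.
  exact: (subN (LS _)).
move=> a w d Sa Ww Sd; have [b [c [Wb Sc ->]]] := lie_word_inv Ww.
have {Wb}Sb : [set x; y; z] b.
  by inversion Wb as [|k u ? Wu]; [|inversion Wu].
rewrite -/(f a b c d).
by move: Sa Sb Sc Sd => [[->|->]|->] [[->|->]|->] [[->|->]|->] [[->|->]|->];
  rewrite ?eq23 //; exact: (sub0 (LS _)).
Qed.

Lemma L_mul_sub_T_odd m n : 3%N \notin [pchar K] ->
  odd m -> (1 < n)%N -> @L_mul_sub_T _ A m n.
Proof.
move=> K3 m_odd n1; apply: L_mul_sub_T_words => w c.
apply: mul_lie_word => //; rewrite -(odd_double_half m) m_odd.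
apply: jordan_bracket_depth_parity => //; first exact: jordan_bracket_depth3.
exact: jordan_bracket_depth1.
Qed.

End Jordan_products.

(** * From words in the generators to arbitrary words *)

Section Extension_from_generators.
Context {K : fieldType} {A : algType K}.
Implicit Types (S : set A) (a b c e p q u w g h : A) (s : seq A).
Local Notation L := (lower_central (A := A)).
Local Notation T := (T_ideal A).
Local Notation LS n := (L_submod (A := A) n).
Local Notation TS n := (T_submod (A := A) n).

(** These are the error terms of the Leibniz rule; both factors have length at least 2, so that
    products with a further commutator fall under smaller cases. *)
Definition L_prods k : set A := linear_span [set z | exists i j p q,
  [/\ (1 < i)%N, (1 < j)%N, (i + j)%N = k, L i p /\ L j q & z = p * q]].

Lemma L_prods_submod k : GRing.submod_closed (mem (L_prods k)).
Proof. exact: linear_span_submod. Qed.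

Lemma L_prods_mul i j p q : (1 < i)%N -> (1 < j)%N -> L i p -> L j q ->
  L_prods (i + j) (p * q).
Proof.
by move=> i1 j1 Lp Lq; apply: linear_span_gen; exists i, j, p, q.
Qed.

Lemma L_prods_bracket k e a : L_prods k e -> L_prods k.+1 (commutator e a).
Proof.
suff: L_prods k `<=` (fun v => commutator v a) @^-1` L_prods k.+1 by exact.
apply: linear_span_ind.
  by apply: preimage_submod; [exact: L_prods_submod|exact: commutator_linearl].
move=> _ [i [j [p [q [i1 j1 <- [Lp Lq] ->]]]]]; rewrite /preimage /=.
have -> : commutator (p * q) a = commutator p a * q + p * commutator q a.
  by ncring.
apply: (subD (L_prods_submod _)).
  by rewrite -addSn; apply: L_prods_mul => //; [lia|exact: L_bracket].
by rewrite -addnS; apply: L_prods_mul => //; [lia|exact: L_bracket].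
Qed.

Lemma foldl_commutator_linear s : linear (fun u : A => foldl commutator u s).
Proof.
elim: s => [//|a s IHs] k u v /=.
by rewrite commutator_linearl IHs.
Qed.

Lemma foldl_commutatorD s u v : foldl commutator (u + v) s =
  foldl commutator u s + foldl commutator v s.
Proof. by have := foldl_commutator_linear s 1 u v; rewrite !scale1r. Qed.

Lemma foldl_commutatorN s u :
  foldl commutator (- u) s = - foldl commutator u s.
Proof. by elim: s u => //= a s IHs u; rewrite commutatorNl IHs. Qed.

Lemma L_foldl i u s : L i u -> L (i + size s) (foldl commutator u s).
Proof.
elim: s i u => [|a s IHs] i u Lu /=; first by rewrite addn0.
by rewrite addnS -addSn; apply: IHs; exact: L_bracket.
Qed.

Lemma L_prods_foldl k e s : L_prods k e ->
  L_prods (k + size s) (foldl commutator e s).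
Proof.
elim: s k e => [|a s IHs] k e Ee /=; first by rewrite addn0.
by rewrite addnS -addSn; apply: IHs; exact: L_prods_bracket.
Qed.

(** Leibniz: in every term other than p [q, s...] some letter has been bracketed with [p], which
    puts that factor in [L 2]. *)
Lemma foldl_commutator_mull p q j s : (1 < j)%N -> L j q ->
  L_prods (j.+1 + size s)
    (foldl commutator (p * q) s - p * foldl commutator q s).
Proof.
elim: s j q => [|a s IHs] j q j1 Lq /=.
  by rewrite subrr; exact: (sub0 (L_prods_submod _)).
have -> : commutator (p * q) a = commutator p a * q + p * commutator q a.
  by ncring.
rewrite foldl_commutatorD -addrA addnS -addSn; apply: (subD (L_prods_submod _)).
  apply: L_prods_foldl; apply: (@L_prods_mul 2) => //.
  by apply: L_bracket; exact: L_one.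
by apply: IHs; [lia|exact: L_bracket].
Qed.

Lemma foldl_commutator_mulr p q j s : (1 < j)%N -> L j q ->
  L_prods (j.+1 + size s)
    (foldl commutator (q * p) s - foldl commutator q s * p).
Proof.
elim: s j q => [|a s IHs] j q j1 Lq /=.
  by rewrite subrr; exact: (sub0 (L_prods_submod _)).
have -> : commutator (q * p) a = q * commutator p a + commutator q a * p.
  by ncring.
rewrite foldl_commutatorD -addrA addnS -addSn; apply: (subD (L_prods_submod _)).
  apply: L_prods_foldl; rewrite -addn2; apply: L_prods_mul => //.
  by apply: L_bracket; exact: L_one.
by apply: IHs; [lia|exact: L_bracket].
Qed.

Section One_factor.
Variables (S : set A) (m n : nat) (c : A).
Hypotheses (S_gen : subalgebra_gen S = setT) (m_gt1 : (1 < m)%N).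
Hypothesis L_prods_c : forall e, L_prods m.+1 e -> T (m + n - 1) (e * c).
Hypothesis L_c : forall e, L m.+1 e -> T (m + n - 1) (e * c).

(* Modulo T_(m+n-1), each entry of a left-normed word times c is a derivation,
   so that the admissible entries form a subalgebra. *)
Lemma entry_from_generators i u s : (0 < i)%N -> L i u ->
    (i.+1 + size s)%N = m ->
    (forall g, S g ->
      T (m + n - 1) (foldl commutator (commutator u g) s * c)) ->
  forall a, T (m + n - 1) (foldl commutator (commutator u a) s * c).
Proof.
move=> i0 Lu im Sc a.
pose M : set A :=
  [set g | T (m + n - 1) (foldl commutator (commutator u g) s * c)].
suff : subalgebra_gen S `<=` M by rewrite S_gen; apply.
apply: smallest_sub => //; split.
- rewrite in_setE /M /= (_ : commutator u 1 = - 0); last by ncring.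
  have -> : foldl commutator (- 0) s = 0.
    elim: (s) => /= [|b t IH]; first by rewrite oppr0.
    by rewrite (_ : commutator (- 0) b = - 0) //; ncring.
  by rewrite mul0r; exact: (sub0 (TS _)).
- move=> k g h; rewrite !in_setE /M /= => Tg Th.
  rewrite commutator_linearr foldl_commutator_linear mulrDl -scalerAl.
  by apply: (subD (TS _)) => //; exact: (subZ (TS _)).
- move=> g h; rewrite !in_setE /M /= => Tg Th.
  pose D v := foldl commutator v s.
  (* The factor [h] is moved to the left of D [u, g], so that the latter stands next to [c]; this
     costs a commutator in [L m.+1]. *)
  have -> : D (commutator u (g * h)) * c =
    (D (g * commutator u h) - g * D (commutator u h)) * c
    + (D (commutator u g * h) - D (commutator u g) * h) * c
    + g * (D (commutator u h) * c) + h * (D (commutator u g) * c)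
    + commutator (D (commutator u g)) h * c.
    have -> : commutator u (g * h) =
        g * commutator u h + commutator u g * h by ncring.
    by rewrite {1}/D foldl_commutatorD -!/(D _); ncring.
  have Lug v : L i.+1 (commutator u v) by exact: L_bracket.
  apply: (subD (TS _)); first apply: (subD (TS _)); first apply: (subD (TS _));
    first apply: (subD (TS _)).
  + apply: L_prods_c; rewrite -im -!addSn.
    exact: foldl_commutator_mull.
  + apply: L_prods_c; rewrite -im -!addSn.
    exact: foldl_commutator_mulr.
  + exact: (ideal_mull (T_is_ideal _)).
  + exact: (ideal_mull (T_is_ideal _)).
  + by apply: L_c; rewrite -im; apply: L_bracket; exact: L_foldl.
Qed.

Lemma word_from_generators :
    (forall w, lie_word S m w -> T (m + n - 1) (w * c)) ->
  forall w, lie_word setT m w -> T (m + n - 1) (w * c).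
Proof.
move=> Sc.
(* Arbitrary letters are on the left and generators in the suffix [s]; the induction extends the
   arbitrary prefix. *)
suff ext i u : lie_word setT i u -> forall s, {in s, forall a, S a} ->
    (i + size s)%N = m -> T (m + n - 1) (foldl commutator u s * c).
  by move=> w Ww; apply: (ext m w Ww [::]); rewrite ?addn0.
elim=> {i u} [a _|i u a Wu IH _] s Ss im.
  case: s Ss im => [|x s] Ss im; first by move: m_gt1; rewrite -im.
  have Sx : S x by apply: Ss; rewrite mem_head.
  have {}Ss : {in s, forall a, S a}.
    by move=> b bs; apply: Ss; rewrite inE bs orbT.
  (* The first letter is not a right-hand entry; antisymmetry makes it one. The letter [x] exists
     because [m > 1]. *)
  rewrite /= (_ : commutator a x = - commutator x a); last by ncring.
  rewrite foldl_commutatorN mulNr; apply: (subN (TS _)).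
  apply: (entry_from_generators (i := 1)) => //; first exact: L_one.
  move=> g Sg; apply: Sc; rewrite -im addnS -addSn.
  by apply: foldl_lie_word => //; do 2?constructor.
apply: (entry_from_generators (i := i)) => //; first exact: lie_word_gt0 Wu.
  exact: L_word Wu.
move=> g Sg; apply: (IH (g :: s)) => [b|]; last by rewrite -im /= addnS.
by rewrite inE => /orP[/eqP->|/Ss].
Qed.

End One_factor.

End Extension_from_generators.

(** * Both indices even, by induction on their sum *)

Section Even_case.
Context {K : fieldType} {A : algType K}.
Hypotheses (K2 : 2%N \notin [pchar K]) (K3 : 3%N \notin [pchar K]).
Implicit Types (S : set A).
Local Notation L := (lower_central (A := A)).
Local Notation T := (T_ideal A).
Local Notation TS n := (T_submod (A := A) n).

Lemma L_mul_sub_T_even S m n : subalgebra_gen S = setT ->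
    jordan_bracket_depth S 2 -> (1 < m)%N -> (1 < n)%N ->
    ~~ odd m -> ~~ odd n ->
  @L_mul_sub_T _ A m n.
Proof.
move=> S_gen C2.
have [N] := ubnP (m + n); elim: N m n => // N IHN m n mnN m1 n1 m_even n_even.
have T_odd k l : odd k -> (1 < l)%N ->
    ideal_prod (T k) (T l) `<=` T (k + l - 1).
  move=> k_odd l1; apply: T_mul_sub_T; [by case: k k_odd|by lia|].
  exact: L_mul_sub_T_odd.
have L_S k l c e : ~~ odd k -> (1 < l)%N -> L l c -> L k.+1 e ->
    T (k + l - 1) (e * c).
  move=> k_even l1 Lc Le; apply: T_subS; first by lia.
  have -> : ((k + l - 1).+1 = k.+1 + l - 1)%N by lia.
  exact: L_mul_sub_T_odd.
(* As [k.+1] is odd, exactly one of the two lengths is odd; that factor is put first and treated by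
   [T_odd], while the even one times [c] is covered by induction. *)
have L_prods_c k l c e : (k + l <= N)%N -> (1 < l)%N -> ~~ odd k -> ~~ odd l ->
    L l c -> L_prods k.+1 e -> T (k + l - 1) (e * c).
  move=> klN l1 k_even l_even Lc.
  suff odd_even i j p q : odd i -> (1 < i)%N -> (1 < j)%N -> (i + j)%N = k.+1 ->
      L i p -> L j q -> T (k + l - 1) (p * q * c).
    suff: L_prods k.+1 `<=` (fun e => e * c) @^-1` T (k + l - 1) by apply.
    apply: linear_span_ind.
      exact: (preimage_submod (TS _) (mulr_linear _)).
    move=> _ [i [j [p [q [i1 j1 ij [Lp Lq] ->]]]]]; rewrite /preimage /=.
    have [i_odd|i_even] := boolP (odd i); first exact: (odd_even i j).
    have -> : p * q * c = q * p * c + commutator p q * c by ncring.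
    apply: (subD (TS _)).
      by apply: (odd_even j i) => //; [lia|rewrite addnC].
    by apply: L_S => //; rewrite -ij; exact: L_commutator.
  move=> i_odd i1 j1 ij Lp Lq; rewrite -mulrA.
  have -> : (k + l - 1 = i + (j + l - 1) - 1)%N by lia.
  apply: T_odd => //; first by lia.
  apply: linear_span_gen; exists p; first by apply: L_sub_T => //; lia.
  by exists (q * c) => //; apply: IHN => //; lia.
have m0 : (0 < m)%N by lia.
have n0 : (0 < n)%N by lia.
have Sm_Tn c w : lie_word S n c -> lie_word setT m w -> T (m + n - 1) (w * c).
  move=> Wc; have Lc := L_word Wc.
  apply: (word_from_generators S_gen) => // [e|e|{}w Ww].
  - by apply: L_prods_c => //; lia.
  - exact: L_S.
  - apply: (mul_lie_word _ _ _ Ww) => //.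
    have -> : m = (2 + (m.-2)./2.*2)%N by lia.
    by apply: jordan_bracket_depth_parity => //; exact: jordan_bracket_depth3.
(* With [w] now arbitrary, the same extension is applied to [c], after a swap that makes it the left
   factor. *)
have Tm_Tn w c : lie_word setT m w -> lie_word setT n c ->
    T (m + n - 1) (w * c).
  move=> Ww Wc; rewrite addnC.
  apply: L_mul_sub_TC => //; [exact: L_word Wc|exact: L_word Ww|].
  have Lw := L_word Ww.
  apply: (word_from_generators S_gen) Wc => // [e|e|{}c Wc].
  - by apply: L_prods_c => //; lia.
  - exact: L_S.
  - rewrite addnC; apply: L_mul_sub_TC => //; first exact: L_word Wc.
    exact: Sm_Tn.
exact: L_mul_sub_T_words.
Qed.

End Even_case.

Theorem mainTheorem1 (K : fieldType) (A : algType K) (x y z : A) (m n : nat)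
    (K_infinite : infinite_set [set: K])
    (char_neq2 : 2%N \notin [pchar K]) (char_neq3 : 3%N \notin [pchar K])
    (A_generated : subalgebra_gen [set x; y; z] = [set: A])
    (m_ge2 : (2 <= m)%N) (n_ge2 : (2 <= n)%N) :
  ideal_prod (T_ideal A m) (T_ideal A n) `<=` T_ideal A (m + n - 1)%N.
Proof.
apply: T_mul_sub_T; [by lia|by lia|].
have [m_odd|m_even] := boolP (odd m); first exact: L_mul_sub_T_odd.
have [n_odd|n_even] := boolP (odd n).
  by apply: L_mul_sub_T_sym; [lia|lia|exact: L_mul_sub_T_odd].
apply: (L_mul_sub_T_even _ _ A_generated) => //.
exact: jordan_bracket_depth2_three.
Qed.
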